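(* Let $G$ and $H$ be finite simple connected non-bipartite graphs, each having at least two universal vertices. Then $\gamma_{P,c}(G\times H)=2$.
   Context: A universal vertex is a vertex adjacent to every other vertex. Power domination: for $S\subseteq V(X)$, start with $M(S)=N[S]$ and repeatedly add a vertex $w$ whenever some $v\in M(S)$ has $w$ as its unique neighbour outside $M(S)$; $S$ is a connected power dominating set if the final $M(S)$ is $V(X)$ and $\langle S\rangle$ is connected; $\gamma_{P,c}(X)$ is the minimum size of such a set. The tensor product $G\times H$ has vertex set $V(G)\times V(H)$, with $(a,b)\sim(x,y)$ iff $ax\in E(G)$ and $by\in E(H)$. *)

(* Defs.v *)
From HB Require Import structures.
From mathcomp Require Import all_boot.

Set Implicit Arguments.
Unset Strict Implicit.
Unset Printing Implicit Defensive.

Record sgraph := SGraph {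
  vertex :> finType;
  adj : rel vertex;
  adj_sym : symmetric adj;
  adj_irr : irreflexive adj
}.

Section Graph.
Variable X : sgraph.
Implicit Types (S M : {set X}) (u v w : X).

(* The graph with no vertex does not count as connected. *)
Definition connected : bool :=
  (0 < #|X|) && [forall x : X, forall y : X, connect (@adj X) x y].

Definition bipartite : bool :=
  [exists A : {set X}, forall x : X, forall y : X,
     adj x y ==> ((x \in A) != (y \in A))].

Definition universal u : bool := [forall v : X, (v != u) ==> adj u v].

Definition nbhd v : {set X} := [set w | adj v w].

Definition closed_nbhd S : {set X} := S :|: \bigcup_(v in S) nbhd v.

Definition forces M v w : bool := (v \in M) && (nbhd v :\: M == [set w]).

Definition propagate M : {set X} := M :|: [set w | [exists v, forces M v w]].

(* All vertices currently forced are added at once; #|X| rounds suffice, and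
   by [run_final] below adding them one at a time, in any order, leads to the
   same final set. *)
Definition monitored S : {set X} := iter #|X| propagate (closed_nbhd S).

Definition power_dominating S : bool := monitored S == [set: X].

Inductive monitoring_run S : {set X} -> Prop :=
| run_start : monitoring_run S (closed_nbhd S)
| run_add M v w :
    monitoring_run S M -> forces M v w -> monitoring_run S (w |: M).

Definition final M : Prop := forall v w, ~~ forces M v w.

End Graph.

Section Constructions.

Lemma induced_sym (X : sgraph) (S : {set X}) :
  symmetric (fun x y : {x : X | x \in S} => adj (val x) (val y)).
Proof. by move=> x y; rewrite adj_sym. Qed.

Lemma induced_irr (X : sgraph) (S : {set X}) :
  irreflexive (fun x y : {x : X | x \in S} => adj (val x) (val y)).
Proof. by move=> x; rewrite adj_irr. Qed.

Definition induced (X : sgraph) (S : {set X}) : sgraph :=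
  SGraph (@induced_sym X S) (@induced_irr X S).

Definition tensor_adj (G H : sgraph) : rel (G * H) :=
  fun p q => adj p.1 q.1 && adj p.2 q.2.

Lemma tensor_sym (G H : sgraph) : symmetric (@tensor_adj G H).
Proof.
by move=> p q; rewrite /tensor_adj (adj_sym p.1) (adj_sym p.2).
Qed.

Lemma tensor_irr (G H : sgraph) : irreflexive (@tensor_adj G H).
Proof. by move=> p; rewrite /tensor_adj adj_irr. Qed.

Definition tensor (G H : sgraph) : sgraph :=
  SGraph (@tensor_sym G H) (@tensor_irr G H).

End Constructions.

Definition connected_power_dominating (X : sgraph) (S : {set X}) : bool :=
  power_dominating S && connected (induced S).

(* The initial value exceeds the size of every subset of X: it is the result
   exactly when X has no connected power dominating set. *)
Definition gamma_Pc (X : sgraph) : nat :=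
  \big[minn/#|X|.+1]_(S : {set X} | connected_power_dominating S) #|S|.

Section Facts.
Variable X : sgraph.
Implicit Types (S M : {set X}) (v w : X).

Lemma propagate_sub_final M N :
  final N -> M \subset N -> propagate M \subset N.
Proof.
move=> finN sMN; rewrite subUset sMN; apply/subsetP=> w.
rewrite inE => /existsP[v /andP[vM /eqP defw]].
apply/negPn/negP=> wN; have /negP[] := finN v w.
rewrite /forces (subsetP sMN) //= eqEsubset -{1}defw setDS //= sub1set.
by have := set11 w; rewrite -defw !inE wN => /andP[_ ->].
Qed.

Lemma monitored_sub_final S N :
  final N -> closed_nbhd S \subset N -> monitored S \subset N.
Proof.
move=> finN sSN; rewrite /monitored.
by elim: #|X| => //= n IHn; apply: propagate_sub_final.
Qed.

Lemma closed_nbhd_sub_monitored S : closed_nbhd S \subset monitored S.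
Proof.
rewrite /monitored; elim: #|X| => //= n IHn.
exact: subset_trans IHn (subsetUl _ _).
Qed.

Lemma propagate_final M : propagate M = M -> final M.
Proof.
move=> fixM v w; apply/negP=> fvw.
have: w \in M by rewrite -fixM !inE; apply/orP; right; apply/existsP; exists v.
case/andP: fvw => _ /eqP defw.
by have := set11 w; rewrite -defw !inE => /andP[/negPf->].
Qed.

Lemma monitored_final S : final (monitored S).
Proof.
apply: propagate_final.
pose N n := iter n (@propagate X) (closed_nbhd S).
have key n : N n.+1 = N n \/ n < #|N n.+1|.
  elim: n => [|n [IHn|IHn]].
  - case: (eqVneq (N 1) (N 0)) => [|neq]; [by left | right].
    apply: leq_ltn_trans (leq0n #|N 0|) (proper_card _).
    by rewrite properEneq eq_sym neq subsetUl.
  - by left; rewrite {1}/N iterS -/(N n.+1) IHn.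
  case: (eqVneq (N n.+2) (N n.+1)) => [|neq]; [by left | right].
  apply: leq_ltn_trans IHn (proper_card _).
  by rewrite properEneq eq_sym neq subsetUl.
by case: (key #|X|) => // /leq_trans/(_ (max_card _)); rewrite ltnn.
Qed.

Lemma run_final S M : monitoring_run S M -> final M -> M = monitored S.
Proof.
move=> runM finM; apply/eqP; rewrite eqEsubset; apply/andP; split; last first.
  apply: monitored_sub_final => //; elim: runM => // N v w _ IHn _.
  exact: subset_trans IHn (subsetUr _ _).
elim: runM => [|N v w _ IHn fvw]; first exact: closed_nbhd_sub_monitored.
have /subsetP sub := propagate_sub_final (@monitored_final S) IHn.
rewrite subUset sub1set IHn andbT; apply: sub.
by rewrite !inE; apply/orP; right; apply/existsP; exists v.
Qed.

Lemma gamma_Pc_le S : connected_power_dominating S -> gamma_Pc X <= #|S|.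
Proof.
move=> cpS; rewrite /gamma_Pc; have := mem_index_enum S.
elim: (index_enum _) => // T r IHr; rewrite inE big_cons.
case/predU1P => [<-|/IHr le_r]; first by rewrite cpS geq_minl.
by case: ifP => // _; apply: leq_trans (geq_minr _ _) le_r.
Qed.

Lemma gamma_Pc_attained S : connected_power_dominating S ->
  exists2 T : {set X}, connected_power_dominating T & #|T| = gamma_Pc X.
Proof.
move=> cpS; have: gamma_Pc X = #|X|.+1 \/
    exists2 T : {set X}, connected_power_dominating T & #|T| = gamma_Pc X.
  rewrite /gamma_Pc; apply: (big_ind (fun m => m = #|X|.+1 \/
    exists2 T : {set X}, connected_power_dominating T & #|T| = m)).
  - by left.
  - by move=> m n Pm Pn; rewrite /minn; case: ifP.
  - by move=> T cpT; right; exists T.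
case=> // gE; have := leq_trans (gamma_Pc_le cpS) (max_card _).
by rewrite gE ltnn.
Qed.

End Facts.

(* Main.v *)
(* Let u1, u2 and v1, v2 be universal in G and H. The adjacent pair (u1, v1),
   (u2, v2) dominates everything but (u1, v2) and (u2, v1), and for b outside
   {v1, v2} these are forced by (u2, b) and (u1, b) respectively. Conversely, in
   a product of graphs of minimum degree at least 2, the set N[(a, b)] is proper
   and forces nothing: any (x, y) with x ~ a and y ~ b also has the unmonitored
   neighbours (a, y') and (x', b), for some y' <> b and x' <> a. *)

Require Import Defs.
From mathcomp Require Import all_boot.

Set Implicit Arguments.
Unset Strict Implicit.
Unset Printing Implicit Defensive.

Lemma in_closed_nbhd (X : sgraph) (S : {set X}) (w : X) :
  (w \in closed_nbhd S) = (w \in S) || [exists v in S, adj v w].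
Proof.
rewrite inE; congr (_ || _); apply/bigcupP/exists_inP => -[v vS].
  by rewrite inE; exists v.
by exists v; rewrite ?inE.
Qed.

(** The monitored set is final and contains [closed_nbhd S], so a round of forcing cannot leave
    it. *)
Lemma propagate_sub_monitored (X : sgraph) (S : {set X}) :
  propagate (closed_nbhd S) \subset monitored S.
Proof.
exact: propagate_sub_final (@monitored_final X S) (closed_nbhd_sub_monitored S).
Qed.

(** With [u] and [v] as the only vertices, every edge would join them, and [[set u]] would be one
    side of a bipartition. *)
Lemma nbipartite_third_vertex (X : sgraph) (u v : X) :
  ~~ bipartite X -> u != v -> exists2 w, w != u & w != v.
Proof.
move=> nbip neq_uv.
have [w /andP[wu wv]|no] := pickP [pred w | (w != u) && (w != v)].
  by exists w.
case/negP: nbip; apply/existsP; exists [set u].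
apply/forallP=> x; apply/forallP=> y; apply/implyP=> xy; rewrite !inE.
have rest z : z != u -> z = v.
  by move=> zu; have := no z; rewrite /= zu => /negbFE/eqP.
have [xu|/rest xv] := eqVneq x u; have [yu|/rest yv] := eqVneq y u => //.
  by rewrite xu yu adj_irr in xy.
by rewrite xv yv adj_irr in xy.
Qed.

Lemma universal_adj (X : sgraph) (u v : X) : universal u -> v != u -> adj u v.
Proof. by move=> /forallP/(_ v)/implyP. Qed.

(** Minimum degree at least 2: among two universal vertices and a third vertex, [x] always has two
    distinct neighbours, and at most one of them is [a]. *)
Lemma other_neighbour (X : sgraph) (a x : X) :
    ~~ bipartite X -> 2 <= #|[set u : X | universal u]| ->
  exists2 x', adj x x' & x' != a.
Proof.
move=> nbip /card_gt1P[u [v [/[!inE] uniu univ neq_uv]]].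
have [w wu wv] := nbipartite_third_vertex nbip neq_uv.
have pick2 y z : adj x y -> adj x z -> y != z ->
    exists2 x', adj x x' & x' != a.
  move=> xy xz; have [->|ya _] := eqVneq y a; last by exists y.
  by rewrite eq_sym; exists z.
have [xu|xu] := eqVneq x u.
  by apply: (pick2 v w); rewrite ?xu ?universal_adj // eq_sym.
have [xv|xv] := eqVneq x v.
  by apply: (pick2 u w); rewrite ?xv ?universal_adj // eq_sym.
by apply: (pick2 u v) => //; rewrite adj_sym universal_adj.
Qed.

Section Tensor.
Variables G H : sgraph.
Implicit Types p q : tensor G H.

Lemma tensorE p q : adj p q = adj p.1 q.1 && adj p.2 q.2.
Proof. by []. Qed.

Lemma tensor_singleton_not_power_dominating p :
    (forall a x : G, exists2 x', adj x x' & x' != a) ->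
    (forall b y : H, exists2 y', adj y y' & y' != b) ->
  ~~ power_dominating [set p].
Proof.
case: p => a b degG degH; set p : tensor G H := (a, b).
have inM q : (q \in closed_nbhd [set p]) = (q == p) || adj p q.
  rewrite in_closed_nbhd inE; congr (_ || _).
  by apply/exists_inP/idP=> [[_ /set1P->] | pq] //; exists p; rewrite ?inE.
have a_out y : y != b -> ((a, y) : tensor G H) \notin closed_nbhd [set p].
  by move=> yb; rewrite inM xpair_eqE (negPf yb) andbF tensorE adj_irr.
have b_out x : x != a -> ((x, b) : tensor G H) \notin closed_nbhd [set p].
  by move=> xa; rewrite inM xpair_eqE (negPf xa) tensorE adj_irr andbF.
have finM : final (closed_nbhd [set p]).
  (* The vertex [p] itself forces nothing, as all its neighbours are already monitored. *)
  move=> q w; apply/negP=> /andP[]; rewrite inM => /predU1P[->|].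
    move=> /eqP/setP/(_ w); rewrite in_setD [w \in nbhd _]in_set !inM set11.
    by case: (adj p w); rewrite ?orbT ?andbF.
  case: q => x y; rewrite tensorE => /andP[/= ax by_] /eqP defw.
  have [x' xx' x'a] := degG a x; have [y' yy' y'b] := degH b y.
  have: ((a, y') : tensor G H) \in [set w].
    by rewrite -defw inE a_out // inE tensorE /= adj_sym ax.
  have: ((x', b) : tensor G H) \in [set w].
    by rewrite -defw inE b_out // inE tensorE /= xx' adj_sym.
  by rewrite !inE => /eqP<- /eqP[/esym/eqP]; rewrite (negPf x'a).
(* Only [y != b] matters here: [(a, y)] witnesses that the final set [closed_nbhd [set p]] is
   proper. *)
have [y _ yb] := degH b b.
apply/negP=> /eqP monT.
have /subsetP/(_ ((a, y) : tensor G H)) :=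
  monitored_sub_final finM (subxx _).
by rewrite monT inE (negPf (a_out _ yb)) => /(_ isT).
Qed.

Lemma tensor_universal_pair_power_dominating (u1 u2 : G) (v1 v2 : H) :
    universal u1 -> universal u2 -> universal v1 -> universal v2 ->
    u1 != u2 -> v1 != v2 -> (exists2 b, b != v1 & b != v2) ->
  power_dominating [set ((u1, v1) : tensor G H); (u2, v2)].
Proof.
move=> U1 U2 V1 V2 u12 v12 [b b1 b2].
set S := [set _; _]; set M := closed_nbhd S.
have u21 : u2 != u1 by rewrite eq_sym.
have v21 : v2 != v1 by rewrite eq_sym.
have adjU (X : sgraph) (u x : X) : universal u -> adj u x = (x != u).
  move=> Uu; apply/idP/idP; last exact: universal_adj.
  by apply: contraTneq => ->; rewrite adj_irr.
pose p12 : tensor G H := (u1, v2); pose p21 : tensor G H := (u2, v1).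
(* A vertex [(x, y)] is missed by both members of [S] iff [x = u1] or [y = v1], and also [x = u2] or
   [y = v2]; distinctness leaves [p12] and [p21]. *)
have inM q : (q \in M) = (q != p12) && (q != p21).
  have -> : (q \in M) = [|| q \in S, adj ((u1, v1) : tensor G H) q
                          | adj ((u2, v2) : tensor G H) q].
    rewrite in_closed_nbhd; congr (_ || _); apply/exists_inP/orP.
      by case=> p /set2P[]->; [left | right].
    by case=> adjq; [exists (u1, v1) | exists (u2, v2)]; rewrite ?set21 ?set22.
  case: q => x y; rewrite !inE !tensorE /= !adjU // !xpair_eqE.
  have [->|] := eqVneq x u1; rewrite ?(negPf u12) ?andbT ?orbF /=.
    by have [->|] := eqVneq y v1; rewrite ?v12.
  have [->|] := eqVneq x u2; rewrite ?andbF ?andbT ?orbF //=.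
    by have [->|] := eqVneq y v2; rewrite ?v21.
  by have [->|] := eqVneq y v1; rewrite ?v12.
(* Sharing the coordinate [u2] with [p21] rules out adjacency to it, so [p12] is the only
   unmonitored neighbour. *)
have force12 : forces M ((u2, b) : tensor G H) p12.
  rewrite /forces inM !xpair_eqE (negPf u21) (negPf b1) andbF /=.
  apply/eqP/setP=> -[x y]; rewrite in_setD inM in_set in_set1 tensorE /=.
  rewrite adjU // negb_and !negbK !xpair_eqE.
  have [->|_] := eqVneq x u2; first by rewrite (negPf u21) andbF.
  rewrite orbF; have [_|//] := eqVneq x u1.
  have [->|//] := eqVneq y v2.
  by rewrite adj_sym adjU.
have force21 : forces M ((u1, b) : tensor G H) p21.
  rewrite /forces inM !xpair_eqE (negPf u12) (negPf b2) andbF /=.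
  apply/eqP/setP=> -[x y]; rewrite in_setD inM in_set in_set1 tensorE /=.
  rewrite adjU // negb_and !negbK !xpair_eqE.
  have [->|_] := eqVneq x u1; first by rewrite (negPf u12) andbF.
  have [_|//] := eqVneq x u2.
  have [->|//] := eqVneq y v1.
  by rewrite adj_sym adjU.
rewrite /power_dominating -subTset.
(* Both forcing vertices lie in [M], so a single round completes the set. *)
apply: subset_trans (propagate_sub_monitored _); apply/subsetP=> q _.
rewrite in_setU inM in_set.
have [->|_] := eqVneq q p12; first by apply/existsP; exists (u2, b).
have [->|//] := eqVneq q p21.
by apply/existsP; exists (u1, b).
Qed.

End Tensor.

Lemma connected_induced_edge (X : sgraph) (x y : X) :
  adj x y -> connected (induced [set x; y]).
Proof.
move=> xy; apply/andP; split.
  by apply/card_gt0P; exists (exist _ x (set21 x y)).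
apply/forallP=> -[p pS]; apply/forallP=> -[q qS].
have [->|neq] := eqVneq (exist _ p pS : induced _) (exist _ q qS).
  exact: connect0.
apply: connect1; move: neq; rewrite -(inj_eq val_inj) /=.
by case/set2P: pS => ->; case/set2P: qS => ->; rewrite ?eqxx // adj_sym.
Qed.

Theorem theorem12 (G H : sgraph)
  (connG : connected G) (connH : connected H)
  (nbipG : ~~ bipartite G) (nbipH : ~~ bipartite H)
  (univG : 2 <= #|[set u : G | universal u]|)
  (univH : 2 <= #|[set u : H | universal u]|) :
  gamma_Pc (tensor G H) = 2.
Proof.
have /card_gt1P[u1 [u2 [/[!inE] U1 U2 u12]]] := univG.
have /card_gt1P[v1 [v2 [/[!inE] V1 V2 v12]]] := univH.
pose S := [set ((u1, v1) : tensor G H); (u2, v2)].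
have cpS : connected_power_dominating S.
  apply/andP; split.
    apply: tensor_universal_pair_power_dominating => //.
    exact: nbipartite_third_vertex.
  by apply: connected_induced_edge; rewrite tensorE /= !universal_adj // eq_sym.
apply/eqP; rewrite eqn_leq; apply/andP; split.
  by apply: leq_trans (gamma_Pc_le cpS) _; rewrite cards2; case: (_ != _).
(* Connectedness of [induced T] includes nonemptiness, which supplies [p]; a minimum set of size
   below 2 is then [[set p]]. *)
have [T /andP[pdT /andP[/card_gt0P[[p pT] _] _]] <-] := gamma_Pc_attained cpS.
rewrite ltnNge; apply/negP=> T1.
have defT : T = [set p].
  by apply/esym/eqP; rewrite eqEcard sub1set pT cards1.
move: pdT; rewrite defT; apply/negP.
apply: tensor_singleton_not_power_dominating => *; exact: other_neighbour.
Qed.
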